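(* Let $X,Y$ be real topological-linear spaces, $\Omega\subseteq X$ nonempty, $f:X\to Y$, $\psi:Y\to\mathbb R$ a seminorm with $\psi\not\equiv0$, and $\varphi:Y\to\mathbb R$ a sublinear functional with $\varphi(0)=0$. Consider $(x^*,\alpha)\in Y^*\times\mathbb R_+$ such that $C:=C_\psi(x^*,\alpha)$ satisfies $\operatorname{int}C\neq\emptyset$ and $\varphi$ is $-C$ representing. Then, for any $\bar x\in\Omega$, the following assertions are equivalent: (1°) $\bar x\in\mathrm{WEff}(\Omega\mid f,C)$. (2°) For any $k\in\operatorname{int}C$, the point $(\bar x,0)$ is a solution of the problem $(P_\varphi^{a,k})$ for $a=f(\bar x)$. If $\varphi$ is strictly $-C$ representing (e.g., if $\varphi=\varphi_{x^*,\alpha}$ and $C^>_\psi(x^*,\alpha)\ne\emptyset$), then (1°) and (2°) are equivalent to: (3°) $\bar x\in\operatorname{argmin}_{x\in\Omega}\varphi(f(x)-f(\bar x))$. If there are sets $\mathcal P\subseteq Y$, $\mathcal T\subseteq\operatorname{int}C$ and $\mathcal R\subseteq\mathbb R$ such that $f[\mathrm{WEff}(\Omega\mid f,C)]\subseteq\mathcal P+\mathcal R\cdot\mathcal T$, then (1°) and (2°) are equivalent to: (4°) There are $a\in\mathcal P$, $k\in\mathcal T$ and $s\in\mathcal R$ so that $(\bar x,s)$ is a solution of $(P_\varphi^{a,k})$. If further $C$ is closed and nontrivial, then (1°), (2°) and (4°) are equivalent to: (5°) There are $a\in\mathcal P$, $k\in\mathcal T$ and $s\in\mathcal R$ so that $s=\varphi^G_{a-C,k}(f(\bar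 x))=\min_{x\in\Omega}\varphi^G_{a-C,k}(f(x))$.
   Context: $Y^*$ is the topological dual of $Y$, $\mathbb R_+=[0,\infty)$. $C_\psi(x^*,\alpha):=\{y\in Y\mid x^*(y)\ge\alpha\psi(y)\}$ (Bishop-Phelps type cone), $C^>_\psi(x^*,\alpha):=\{y\in Y\mid x^*(y)>\alpha\psi(y)\}$, $\varphi_{x^*,\alpha}(y):=x^*(y)+\alpha\psi(y)$. A cone $C$ is nontrivial if $\{0\}\neq C\neq Y$. $\varphi$ is $-C$ representing if $-C=\{y\in Y\mid\varphi(y)\le0\}$, and strictly $-C$ representing if in addition $-\operatorname{int}C=\{y\in Y\mid\varphi(y)<0\}$. $\mathrm{WEff}(\Omega\mid f,C)$ is the set of $\bar x\in\Omega$ for which there is no $x\in\Omega$ with $f(x)\in f(\bar x)-\operatorname{int}C$. $f[D]$ is the image of $D$ under $f$. For $a,k\in Y$, $(P_\varphi^{a,k})$ is the problem: minimize $\lambda$ subject to $\varphi(f(x)-a-\lambda k)\le0$, $(x,\lambda)\in\Omega\times\mathbb R$; a solution is a feasible pair $(x,\lambda)$ with $\lambda$ minimal among all feasible pairs. $\varphi^G_{a-C,k}(y):=\inf\{t\in\mathbb R\mid y\in tk+(a-C)\}\in\mathbb R\cup\{\pm\infty\}$ ($\inf\emptyset=+\infty$). *)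

(* Defs.v *)
From HB Require Import structures.
From mathcomp Require Import all_boot all_order all_algebra.
From mathcomp Require Import all_classical all_reals all_analysis.

Set Implicit Arguments.
Unset Strict Implicit.
Unset Printing Implicit Defensive.

Import Order.TTheory GRing.Theory Num.Theory.
Import numFieldNormedType.Exports.

Local Open Scope classical_set_scope.
Local Open Scope ring_scope.

Definition seminorm (R : realType) (Y : lmodType R) (psi : Y -> R) : Prop :=
  [/\ forall y, 0 <= psi y,
      forall x y, psi (x + y) <= psi x + psi y &
      forall (t : R) y, psi (t *: y) = `|t| * psi y].

Definition sublinear (R : realType) (Y : lmodType R) (phi : Y -> R) : Prop :=
  (forall x y, phi (x + y) <= phi x + phi y) /\
  (forall (t : R) y, 0 < t -> phi (t *: y) = t * phi y).

(* Bishop-Phelps type cones and functionals, meant for xs in the topological dual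
   and psi a seminorm, not assumed continuous. *)
Definition bp_cone (R : realType) (Y : lmodType R) (psi xs : Y -> R)
    (alpha : R) : set Y :=
  [set y | alpha * psi y <= xs y].

Definition bp_cone_gt (R : realType) (Y : lmodType R) (psi xs : Y -> R)
    (alpha : R) : set Y :=
  [set y | alpha * psi y < xs y].

Definition bp_functional (R : realType) (Y : lmodType R) (psi xs : Y -> R)
    (alpha : R) : Y -> R :=
  fun y => xs y + alpha * psi y.

Definition nontrivial_cone (R : realType) (Y : lmodType R) (C : set Y) : Prop :=
  C <> [set 0] /\ C <> setT.

(* phi is "-C representing", hence the prefix "opp". *)
Definition opp_representing (R : realType) (Y : lmodType R) (C : set Y)
    (phi : Y -> R) : Prop :=
  [set - y | y in C] = [set y | phi y <= 0].

Definition strictly_opp_representing (R : realType)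
    (Y : topologicalLmodType R) (C : set Y) (phi : Y -> R) : Prop :=
  opp_representing C phi /\
  [set - y | y in interior C] = [set y | phi y < 0].

Definition weff (R : realType) (X : Type) (Y : topologicalLmodType R)
    (Omega : set X) (f : X -> Y) (C : set Y) : set X :=
  [set xb | Omega xb /\
    ~ exists2 x, Omega x & [set f xb - c | c in interior C] (f x)].

Definition argmin (d : Order.disp_t) (T : Type) (V : porderType d)
    (D : set T) (g : T -> V) : set T :=
  [set x | D x /\ forall y, D y -> (g x <= g y)%O].

Definition is_minimum (d : Order.disp_t) (V : porderType d)
    (A : set V) (m : V) : Prop :=
  A m /\ lbound A m.

(* The points (x, lambda) satisfying the constraints of the scalar problem
   "minimize lambda subject to phi (f x - a - lambda k) <= 0". *)
Definition scal_feasible (R : realType) (X : Type) (Y : lmodType R)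
    (Omega : set X) (f : X -> Y) (phi : Y -> R) (a k : Y) : set (X * R) :=
  [set p | Omega p.1 /\ phi (f p.1 - a - p.2 *: k) <= 0].

Definition scal_solution (R : realType) (X : Type) (Y : lmodType R)
    (Omega : set X) (f : X -> Y) (phi : Y -> R) (a k : Y) : set (X * R) :=
  argmin (scal_feasible Omega f phi a k) snd.

(* The infimum is taken in \bar R: it is +oo when no t is admissible. *)
Definition gerstewitz (R : realType) (Y : lmodType R) (A : set Y) (k y : Y) :
    \bar R :=
  ereal_inf [set t%:E | t in [set t : R | [set t *: k + c | c in A] y]].

(* Main.v *)
(** The representing property turns the constraint of the scalar problem into
    [a + lambda k - f x \in C], and everything rests on two facts about a convex
    cone [C]: [c + t k \in int C] for [c \in C], [k \in int C] and [t > 0], and every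
    [c \in int C] satisfies [c - e d \in C] for small [e > 0].  The first one
    shows that a feasible value smaller than the expected optimum would give a
    point of [f xb - int C]; the second one shows that a point of
    [f xb - int C] allows the optimal value to be decreased.  In (5), [C] closed
    makes the infimum defining the Gerstewitz functional attained. *)

Require Import Defs.
From HB Require Import structures.
From mathcomp Require Import all_boot all_order all_algebra.
From mathcomp Require Import all_classical all_reals all_analysis.
From mathcomp Require Import lra.

Set Implicit Arguments.
Unset Strict Implicit.
Unset Printing Implicit Defensive.

Import Order.TTheory GRing.Theory Num.Theory.
Import numFieldNormedType.Exports.

Local Open Scope classical_set_scope.
Local Open Scope ring_scope.

(** * Convex cones in topological vector spaces *)

Definition convex_cone (R : realType) (Y : lmodType R) (C : set Y) : Prop :=
  (forall x y, C x -> C y -> C (x + y)) /\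
  (forall (t : R) y, 0 < t -> C y -> C (t *: y)).

(** Joint continuity of addition and scaling; the limits used below vary either the scalar or the
    vector [u], [v]. *)
Lemma affine_comb_cvg (R : realType) (Y : topologicalLmodType R) (T : Type)
    (F : set_system T) (FF : Filter F) (g : T -> R) (r : R) (u v : T -> Y)
    (x y : Y) :
  (g @ F --> r) -> (u @ F --> x) -> (v @ F --> y) ->
  (fun z => u z + g z *: v z) @ F --> x + r *: y.
Proof.
move=> gr ux vy.
have gv : (fun z => g z *: v z) @ F --> r *: y.
  apply: (cvg_comp2 gr vy).
  exact: (@scale_continuous R Y (r, y)).
apply: (cvg_comp2 ux gv).
exact: (@add_continuous Y (x, r *: y)).
Qed.

(** The continuous map [h z = t^-1 (z - c)] sends [c + t k] to [k], so it maps points near [c + t k]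
    into [C]; there [z = c + t (h z)] lies in [C] as well. *)
Lemma interiorD_convex_cone (R : realType) (Y : topologicalLmodType R)
    (C : set Y) (c k : Y) (t : R) :
  convex_cone C -> C c -> interior C k -> 0 < t -> interior C (c + t *: k).
Proof.
move=> [CD CZ] Cc Ck t0.
pose h z : Y := - (t^-1 *: c) + t^-1 *: z.
have hk : h (c + t *: k) = k.
  by rewrite /h scalerDr scalerA mulVf ?gt_eqF// scale1r addKr.
have hcvg : h @ (c + t *: k) --> h (c + t *: k).
  apply: (@affine_comb_cvg _ _ _ _ _ (fun=> t^-1) _ (fun=> - (t^-1 *: c)) id).
  - exact: cvg_cst.
  - exact: cvg_cst.
  - exact: cvg_id.
have hC : nbhs (c + t *: k) (h @^-1` C) by apply: hcvg; rewrite hk.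
rewrite /interior; apply: filterS hC => z hz.
have -> : z = c + t *: h z.
  by rewrite /h scalerDr scalerN !scalerA mulfV ?gt_eqF// !scale1r addNKr.
by apply: CD => //; exact: CZ.
Qed.

(** [c - e d] tends to [c] as [e] decreases to 0, hence enters the neighbourhood [C] of [c]. *)
Lemma interior_absorb (R : realType) (Y : topologicalLmodType R)
    (C : set Y) (c d : Y) :
  interior C c -> exists2 e : R, 0 < e & C (c - e *: d).
Proof.
move=> Cc.
have lim : (fun e : R => c + e *: - d) @ (0 : R)^'+ --> c + (0 : R) *: - d.
  apply: affine_comb_cvg; [|exact: cvg_cst|exact: cvg_cst].
  by apply: cvg_at_right_filter; exact: cvg_id.
rewrite scale0r addr0 in lim.
have [e [e0 Ce]] := @filter_ex _ ((0 : R)^'+) _ _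
  (filterI (nbhs_right_gt (0 : R)) (lim _ Cc)).
by exists e => //; move: Ce; rewrite /= scalerN.
Qed.

Lemma closed_add_scale (R : realType) (Y : topologicalLmodType R)
    (C : set Y) (u k : Y) :
  closed C -> (forall e : R, 0 < e -> C (u + e *: k)) -> C u.
Proof.
move=> clC Ce.
have lim : (fun e : R => u + e *: k) @ (0 : R)^'+ --> u + (0 : R) *: k.
  apply: affine_comb_cvg; [|exact: cvg_cst|exact: cvg_cst].
  by apply: cvg_at_right_filter; exact: cvg_id.
rewrite scale0r addr0 in lim.
apply: (closed_cvg C clC _ _ lim).
by near=> e; apply: Ce; near: e; exact: nbhs_right_gt.
Unshelve. all: by end_near. Qed.

(** * Bishop-Phelps cones *)

Lemma bp_cone_convex (R : realType) (Y : lmodType R) (psi : Y -> R)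
    (xs : {scalar Y}) (alpha : R) :
  seminorm psi -> 0 <= alpha -> convex_cone (bp_cone psi xs alpha).
Proof.
move=> [_ psiD psiZ] a0; rewrite /bp_cone; split=> [x y|t y t0] /=.
  rewrite [xs (_ + _)]linearD => Cx Cy; apply: le_trans (lerD Cx Cy).
  by rewrite -mulrDr ler_wpM2l.
by rewrite [xs (_ *: _)]linearZ /= psiZ gtr0_norm// mulrCA ler_pM2l.
Qed.

(* [psi] need not be continuous, so [bp_cone_gt] is not open for free: a point of
   it is written as an element of the cone plus a small multiple of a given
   interior point. *)
Lemma interior_bp_cone (R : realType) (Y : topologicalLmodType R)
    (psi : Y -> R) (xs : {scalar Y}) (alpha : R) :
  seminorm psi -> 0 <= alpha -> interior (bp_cone psi xs alpha) !=set0 ->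
  bp_cone_gt psi xs alpha !=set0 ->
  interior (bp_cone psi xs alpha) = bp_cone_gt psi xs alpha.
Proof.
move=> semi a0 [c0 Cc0] [y0 Cy0]; have [_ psiD psiZ] := semi.
apply/seteqP; split=> y.
  (* Write [y] as [(y - e y0) + e y0]: the first term satisfies the cone inequality and the second
     satisfies it strictly, so subadditivity of [psi] makes it strict at [y]. *)
  move=> /[dup] /interior_subset Cy /(@interior_absorb _ _ _ _ y0)[e e0].
  rewrite /bp_cone /bp_cone_gt /= in Cy Cy0 *.
  rewrite [xs (_ - _)]linearB [xs (_ *: _)]linearZ /= => Ce.
  have := psiD (y - e *: y0) (e *: y0).
  rewrite subrK psiZ gtr0_norm// => /(ler_wpM2l a0); rewrite mulrDr => psiy.
  have : e * (alpha * psi y0) < e * xs y0 by rewrite ltr_pM2l.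
  by lra.
rewrite /bp_cone_gt /= => Cy.
(* Subtracting [t c0] from [y] costs at most [t (xs c0 + alpha psi c0) <= t M] in the cone
   inequality. The summand 1 makes [M] positive, and [t] is chosen so that [t M] is exactly the
   slack at [y]. *)
pose M := `|xs c0| + alpha * psi c0 + 1.
have M0 : 0 < M.
  by case: semi => psi0 _ _; rewrite ltr_wpDl// addr_ge0// mulr_ge0.
pose t := (xs y - alpha * psi y) / M.
have t0 : 0 < t by rewrite divr_gt0// subr_gt0.
rewrite -(subrK (t *: c0) y).
apply: interiorD_convex_cone => //; first exact: bp_cone_convex.
rewrite /bp_cone /= [xs (_ - _)]linearB [xs (_ *: _)]linearZ /=.
have := psiD y (- (t *: c0)).
rewrite -scaleNr psiZ normrN gtr0_norm// => /(ler_wpM2l a0).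
rewrite mulrDr => psiy.
have tM : t * M = xs y - alpha * psi y by rewrite /t divfK// gt_eqF.
have : t * xs c0 <= t * `|xs c0| by rewrite ler_pM2l// ler_norm.
by move: tM; rewrite /M; lra.
Qed.

(** * Representing functionals and the scalar problem *)

Lemma opp_representingP (R : realType) (Y : lmodType R) (C : set Y)
    (phi : Y -> R) (y : Y) :
  opp_representing C phi -> phi y <= 0 <-> C (- y).
Proof.
rewrite /opp_representing => /seteqP[sub1 sub2]; split=> [/sub2[z Cz <-]|Cy].
  by rewrite opprK.
by apply: sub1; exists (- y); rewrite ?opprK.
Qed.

Lemma scal_feasibleP (R : realType) (X : Type) (Y : lmodType R)
    (Omega : set X) (f : X -> Y) (C : set Y) (phi : Y -> R) (a k : Y)
    (x : X) (t : R) :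
  opp_representing C phi ->
  scal_feasible Omega f phi a k (x, t) <-> Omega x /\ C (a + t *: k - f x).
Proof.
move=> rep; rewrite /scal_feasible /= (opp_representingP _ rep).
by rewrite !opprB addrCA addrA.
Qed.

Section Scalarization.
Variables (R : realType) (X : Type) (Y : topologicalLmodType R).
Variables (Omega : set X) (f : X -> Y) (C : set Y) (phi : Y -> R).
Hypothesis cone : convex_cone C.
Hypothesis rep : opp_representing C phi.

(** Stated for an arbitrary decomposition of [f xb], so that it serves (2) with [a = f xb], [s = 0]
    as well as (4). *)
Lemma weff_scal_solution (a k : Y) (s : R) (xb : X) :
  C 0 -> interior C k -> f xb = a + s *: k ->
  weff Omega f C xb -> scal_solution Omega f phi a k (xb, s).
Proof.
move=> C0 Ck fxb [Oxb eff]; split.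
  by apply/(scal_feasibleP _ _ _ _ _ _ rep); rewrite -fxb subrr.
move=> [x t] /(scal_feasibleP _ _ _ _ _ _ rep)[Ox Ct] /=.
rewrite leNgt; apply/negP => ts; apply: eff; exists x => //=.
exists (f xb - f x); last by rewrite subKr.
have -> : f xb - f x = a + t *: k - f x + (s - t) *: k.
  by rewrite fxb [RHS]addrAC -[a + t *: k + _]addrA -scalerDl subrKC.
by apply: interiorD_convex_cone; rewrite ?subr_gt0.
Qed.

Lemma scal_solution_weff (a k : Y) (s : R) (xb : X) :
  scal_solution Omega f phi a k (xb, s) -> weff Omega f C xb.
Proof.
move=> [/(scal_feasibleP _ _ _ _ _ _ rep)[Oxb Cs] mins]; split => //.
case=> x Ox [c /(@interior_absorb _ _ _ _ k)[e e0 Ce] fx].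
suff /mins : scal_feasible Omega f phi a k (x, s - e).
  by rewrite /= lerBDr gerDl leNgt e0.
apply/(scal_feasibleP _ _ _ _ _ _ rep); split => //.
(* Feasibility of [(xb, s)] puts the first summand in [C], and the choice of [e] the second. *)
have -> : a + (s - e) *: k - f x = a + s *: k - f xb + (c - e *: k).
  by rewrite -fx opprB scalerBl [a + (_ - _)]addrA [LHS]addrACA [RHS]addrACA
    [- (e *: k) + _]addrC.
by case: cone => + _; apply.
Qed.

(** * The Gerstewitz functional *)

Lemma gerstewitz_le (a k y : Y) (t : R) :
  C (a + t *: k - y) -> (gerstewitz [set (a - c)%R | c in C] k y <= t%:E)%E.
Proof.
move=> Ct; apply: ereal_inf_lbound; exists t => //.
exists (a - (a + t *: k - y)); first by exists (a + t *: k - y).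
by rewrite opprB addrA [_ + a]addrC subrKC.
Qed.

(** Since [y = t k + (a - c)] means [c = a + t k - y], bounding the extended infimum from below
    amounts to bounding real parameters. *)
Lemma gerstewitz_lbP (a k y : Y) (s : R) :
  (s%:E <= gerstewitz [set (a - c)%R | c in C] k y)%E <->
  forall t : R, C (a + t *: k - y) -> s <= t.
Proof.
split=> [lb t /gerstewitz_le|lb].
  by rewrite -lee_fin; exact: le_trans.
apply/ereal_infP => _ [t [_ [c Cc <-] yE] <-].
by rewrite lee_fin lb// -yE opprD addrA addrK subKr.
Qed.

Lemma scal_solutionP (a k : Y) (s : R) (xb : X) :
  closed C -> C k -> Omega xb ->
  scal_solution Omega f phi a k (xb, s) <->
  s%:E = gerstewitz [set a - c | c in C] k (f xb) /\
  is_minimum [set gerstewitz [set a - c | c in C] k (f x) | x in Omega] s%:E.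
Proof.
move=> clC Ck Oxb; split.
  move=> [/(scal_feasibleP _ _ _ _ _ _ rep)[_ Cs] mins].
  have lb x : Omega x ->
      (s%:E <= gerstewitz [set (a - c)%R | c in C] k (f x))%E.
    move=> Ox; apply/gerstewitz_lbP => t Ct.
    by apply: (mins (x, t)); exact/(scal_feasibleP _ _ _ _ _ _ rep).
  have sE : s%:E = gerstewitz [set a - c | c in C] k (f xb).
    apply/eqP; rewrite eq_le lb//=.
    exact: gerstewitz_le.
  split=> //; split; first by exists xb.
  by move=> _ [x Ox <-]; exact: lb.
move=> [sE [_ mins]].
have lb x t : Omega x -> C (a + t *: k - f x) -> s <= t.
  move=> Ox; apply: (iffLR (gerstewitz_lbP a k (f x) s)).
  by apply: mins; exists x.
split; last by move=> [x t] /(scal_feasibleP _ _ _ _ _ _ rep)[]; exact: lb.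
apply/(scal_feasibleP _ _ _ _ _ _ rep); split=> //.
(* The infimum at [xb] is [s], so some admissible [t] is below [s + e]; adding [(s + e - t) k] shows
   that [s + e] is admissible too. *)
apply: (@closed_add_scale _ _ _ _ k clC) => e e0.
have /existsNP[t /not_implyP[Ct /negP]] :
    ~ forall t, C (a + t *: k - f xb) -> s + e <= t.
  by move/gerstewitz_lbP; rewrite -sE lee_fin gerDl leNgt e0.
rewrite -ltNge -subr_gt0 => te.
have -> : a + s *: k - f xb + e *: k = a + t *: k - f xb + (s + e - t) *: k.
  by rewrite addrAC -[a + s *: k + _]addrA -scalerDl [RHS]addrAC
    -[a + t *: k + _]addrA -scalerDl subrKC.
by case: cone => CD CZ; apply: CD => //; exact: CZ.
Qed.

End Scalarization.

Theorem proposition18 (R : realType) (X Y : topologicalLmodType R)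
    (Omega : set X) (f : X -> Y) (psi phi : Y -> R)
    (xs : {scalar Y}) (alpha : R) :
  Omega !=set0 ->
  seminorm psi -> (exists y, psi y <> 0) ->
  sublinear phi -> phi 0 = 0 ->
  continuous xs -> 0 <= alpha ->
  let C := bp_cone psi xs alpha in
  interior C !=set0 ->
  opp_representing C phi ->
  (phi = bp_functional psi xs alpha ->
   bp_cone_gt psi xs alpha !=set0 ->
   strictly_opp_representing C phi) /\
  forall xb : X, Omega xb ->
  let A1 := weff Omega f C xb in
  let A2 := forall k : Y, interior C k ->
              scal_solution Omega f phi (f xb) k (xb, 0) in
  let A3 := argmin Omega (fun x => phi (f x - f xb)) xb in
  [/\ [<-> A1; A2],
      strictly_opp_representing C phi -> [<-> A1; A2; A3] &
      forall (P T : set Y) (S : set R),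
        T `<=` interior C ->
        f @` weff Omega f C `<=`
          [set a + v | a in P & v in [set s *: k | s in S & k in T]] ->
        let A4 := exists (a k : Y) (s : R),
          [/\ P a, T k, S s & scal_solution Omega f phi a k (xb, s)] in
        let A5 := exists (a k : Y) (s : R),
          [/\ P a, T k, S s,
              s%:E = gerstewitz [set a - c | c in C] k (f xb) &
              is_minimum
                [set gerstewitz [set a - c | c in C] k (f x) | x in Omega]
                s%:E] in
        [<-> A1; A2; A4] /\
        (closed C -> nontrivial_cone C -> [<-> A1; A2; A4; A5])].
Proof.
move=> _ semi _ _ phi0 _ a0 C intC rep; split.
  move=> phiE gt0; split=> //.
  (* With the interior identified, the claim follows from [psi] being even and [xs] odd. *)
  rewrite interior_bp_cone// phiE /bp_functional /bp_cone_gt.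
  have [_ _ psiZ] := semi.
  have psiN y : psi (- y) = psi y by rewrite -scaleN1r psiZ normrN1 mul1r.
  apply/seteqP; split=> [_ [y /= Cy <-]|y /= Cy].
    by rewrite [xs (- _)]linearN psiN /=; lra.
  by exists (- y); rewrite ?opprK//= linearN psiN /=; lra.
move=> xb Oxb A1 A2 A3.
have cone : convex_cone C by exact: bp_cone_convex.
have C0 : C 0 by rewrite -oppr0; apply/(opp_representingP _ rep); rewrite phi0.
have A12 : A1 -> A2.
  move=> eff k Ck; apply: (weff_scal_solution cone rep) => //.
  by rewrite scale0r addr0.
have A21 : A2 -> A1.
  by have [k Ck] := intC => /(_ k Ck); exact: scal_solution_weff.
split; first by tfae.
  move=> [_ srep].
  have ltP y : phi y < 0 <-> interior C (- y).
    have /seteqP[sub1 sub2] := srep.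
    split=> [/sub2[c Cc <-]|Cy]; first by rewrite opprK.
    by apply: sub1; exists (- y); rewrite ?opprK.
  (* The value at [xb] is [phi 0 = 0], so minimality excludes exactly the [x] with negative value,
     that is, with [f xb - f x] in the interior of [C]. *)
  tfae; first by [].
    move=> /A21[_ eff]; split=> // x Ox; rewrite subrr phi0 leNgt.
    apply/negP => /ltP; rewrite opprB => Cx.
    by apply: eff; exists x => //; exists (f xb - f x) => //; rewrite subKr.
  move=> [_ mins]; split=> // -[x Ox [c Cc fx]].
  have := mins x Ox; rewrite subrr phi0 leNgt => /negP; apply.
  by apply/ltP; rewrite -fx opprB subKr.
move=> P T S TC fP A4 A5.
have A14 : A1 -> A4.
  (* The covering hypothesis on [P], [T], [S] supplies the decomposition [f xb = a + s k]. *)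
  move=> eff; have [a Pa [_ [s Ss [k Tk <-]] fxb]] := fP _ (imageP f eff).
  exists a, k, s; split=> //.
  by apply: (weff_scal_solution cone rep) => //; exact: TC.
have A41 : A4 -> A1.
  by move=> [a [k [s [_ _ _]]]]; exact: scal_solution_weff.
split; first by tfae => // /A21.
move=> clC _.
have A45 : A4 <-> A5.
  split=> -[a [k [s]]].
    move=> [Pa Tk Ss]; have Ck := interior_subset (TC _ Tk).
    move=> /(scal_solutionP f cone rep a s clC Ck Oxb)[? ?].
    by exists a, k, s; split.
  move=> [Pa Tk Ss sE mins]; exists a, k, s; split=> //.
  apply/(scal_solutionP f cone rep) => //.
  exact: interior_subset (TC _ Tk).
tfae => //; first by move=> /A21.
- by move=> /A45.
- by move=> /A45.
Qed.
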